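(* Let $n\in\mathbb{N}$ and $N,M\in\mathbb{N}_0$. If $A(1,n;N,M)\in\mathbb{Z}[q]$, then for any nonnegative integer $m$ we have $$n^2\ \Big|\ \sum_{j=1}^{n}w^{-jM}(1+w^j)^{N+mn},$$ where $w=e^{2\pi i/n}$ is a primitive $n$th root of unity.
   Context: $\mathbb{N}$ is the set of positive integers and $\mathbb{N}_0=\mathbb{N}\cup\{0\}$. $\mathbb{Z}[q]$ is the set of polynomials in $q$ with integer coefficients. Let $(q;q)_0=1$ and $(q;q)_n=\prod_{i=1}^{n}(1-q^i)$. For $m,n\in\mathbb{N}_0$ the $q$-binomial coefficient is $\left[{n\atop m}\right]=\frac{(q;q)_n}{(q;q)_m(q;q)_{n-m}}$ if $n\geq m\geq 0$, and $0$ otherwise. For $a\in\mathbb{N}$ and $b,m,n\in\mathbb{N}_0$ define $$A(b,a;n,m)=\frac{1-q^b}{1-q^a}\left[{n\atop m}\right].$$ The statement $A(b,a;n,m)\in\mathbb{Z}[q]$ means that this rational function of $q$ is a polynomial in $q$ with integer coefficients.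
   Formalization: The formal theorem adds M ≤ N: for N < M the q-binomial is 0 by convention, so A(1,n;N,M)=0 lies in Z[q] trivially and the claim can fail, e.g. n=2, N=1, M=2, m=0 gives the sum 2, not divisible by 4. *)

(* Defs.v *)
From mathcomp Require Import all_boot all_order all_algebra.
From mathcomp Require Import complex.
From mathcomp Require Import reals trigo.

Set Implicit Arguments.
Unset Strict Implicit.
Unset Printing Implicit Defensive.

Import Order.TTheory GRing.Theory Num.Theory.

Local Open Scope ring_scope.
Local Open Scope complex_scope.

(** The indeterminate [q] is ['X] in [{poly int}]; rational functions of [q]
    live in the fraction field of [{poly int}]. *)

Definition qpoch (n : nat) : {poly int} := \prod_(1 <= i < n.+1) (1 - 'X^i).

Definition qbinom (n m : nat) : {fraction {poly int}} :=
  if (m <= n)%N then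
    tofrac (qpoch n) / (tofrac (qpoch m) * tofrac (qpoch (n - m)))
  else 0.

(** Meaningful only for [0 < a]: for [a = 0] the denominator is [0]. *)
Definition qA (b a n m : nat) : {fraction {poly int}} :=
  tofrac (1 - 'X^b) / tofrac (1 - 'X^a) * qbinom n m.

Definition in_Zq (f : {fraction {poly int}}) : Prop :=
  exists p : {poly int}, f = tofrac p.

(** [e^(i t)] for a real [t], through Euler's formula. *)
Definition expi (R : realType) (t : R) : R[i] := cos t +i* sin t.

Definition zeta (R : realType) (n : nat) : R[i] := expi (2 * pi / n%:R).

(** [d] divides, in the ring of integers, the complex number [z]; in
    particular [z] is an integer. *)
Definition dvdC_int (R : realType) (d : nat) (z : R[i]) : Prop :=
  exists s : int, z = s%:~R /\ (d%:Z %| s)%Z.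

(* Main.v *)
Require Import Defs.
From mathcomp Require Import all_boot all_order all_algebra.
From mathcomp Require Import complex.
From mathcomp Require Import reals trigo.
From mathcomp Require Import ring lra zify.

(** Expanding the binomial and summing over the powers of [w] keeps only the
    exponents [k] congruent to [M] modulo [n]: the sum is [n] times the sum of
    the binomial coefficients ['C(N + m * n, k)] over those [k]
    ([root_of_unity_filter]). It is therefore enough that [n] divides each of
    these coefficients separately.

    The hypothesis gives this through the roots of unity of order [d], for
    [d > 1] dividing [n]. Such a root is a root of [1 - q^i] exactly when [d]
    divides [i], and then a simple one, so its multiplicity in [(q;q)_N] is
    [N %/ d] ([mup_qpoch]). In the q-binomial coefficient it is
    [N %/ d - M %/ d - (N - M) %/ d], which is [1] or [0] according to whether
    [N %% d < M %% d] ([carry_divn]). The factor [1 - q^n] takes one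
    such root away, while [1 - q] does not vanish there: that the quotient is a
    polynomial forces [N %% d < M %% d] for all these [d] ([qA_in_Zq_carry]).

    This condition depends only on [N] and [M] modulo [n], so it still holds
    for [N + m * n] and any [k] congruent to [M]. By Kummer's theorem
    ([logn_bin]), the exponent of a prime [p] in a binomial coefficient counts
    the powers of [p] at which such an inequality of remainders holds. It
    therefore is at least the exponent of [p] in [n] ([dvdn_bin_carry]). *)

Import Order.TTheory GRing.Theory Num.Theory.

Local Open Scope ring_scope.

(** The remainder inequality says that adding [M] and [N - M] in base [d]
    produces a carry out of the last digit. *)
Lemma carry_divn d N M : (0 < d)%N -> (M <= N)%N ->
  (N %/ d = M %/ d + (N - M) %/ d + (N %% d < M %% d))%N.
Proof.
move=> d0 hMN.
have [X hX] : exists X, N = (M + X)%N by exists (N - M)%N; rewrite subnKC.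
rewrite {}hX in hMN *; rewrite addKn divnD //; congr (_ + nat_of_bool _)%N.
rewrite modnD //; have := ltn_pmod X d0; have := ltn_pmod M d0.
by case: (leqP d (M %% d + X %% d)) => /=; lia.
Qed.

(** Legendre's formula up to any bound [B >= n], the further terms being zero:
    the three factorials of a binomial coefficient need a common range. *)
Lemma logn_fact_widen p n B : prime p -> (n <= B)%N ->
  logn p n`! = (\sum_(1 <= k < B.+1) n %/ p ^ k)%N.
Proof.
move=> p_pr nB; rewrite logn_fact // (@big_cat_nat _ _ _ n.+1 1 B.+1) //=.
rewrite [X in _ = (_ + X)%N]big_nat_cond [X in _ = (_ + X)%N]big1 ?addn0 // => k.
rewrite andbT => /andP[nk _]; apply: divn_small.
exact: ltn_trans nk (ltn_expl _ (prime_gt1 p_pr)).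
Qed.

(** Kummer's theorem: Legendre's formula for the three factorials, compared
    term by term through [carry_divn]. *)
Lemma logn_bin p n m B : prime p -> (m <= n)%N -> (n <= B)%N ->
  logn p 'C(n, m) = (\sum_(1 <= k < B.+1) (n %% p ^ k < m %% p ^ k))%N.
Proof.
move=> p_pr mn nB; apply/eqP.
have /(congr1 (logn p)) := bin_fact mn.
rewrite !lognM ?muln_gt0 ?fact_gt0 ?bin_gt0 //.
rewrite !(@logn_fact_widen p _ B) //; first last.
- exact: leq_trans nB.
- by rewrite (leq_trans _ nB) ?leq_subr.
rewrite -big_split /= => h.
rewrite -(eqn_add2r (\sum_(1 <= k < B.+1) (m %/ p ^ k + (n - m) %/ p ^ k))) h.
rewrite -big_split /=; apply/eqP/eq_bigr => k _.
by rewrite addnC -carry_divn // expn_gt0 prime_gt0.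
Qed.

(** For a prime [p], the hypothesis at [d = p ^ i] with [1 <= i <= logn p t]
    makes [logn p t] terms of Kummer's sum equal to [1]. *)
Lemma dvdn_bin_carry t n m : (0 < t)%N -> (m <= n)%N ->
  (forall d, (1 < d)%N -> (d %| t)%N -> (n %% d < m %% d)%N) ->
  (t %| 'C(n, m))%N.
Proof.
move=> t0 mn H; apply/dvdn_partP => // p.
rewrite mem_primes => /andP[p_pr _].
rewrite p_part pfactor_dvdn ?bin_gt0 //.
(* The range of Kummer's sum must reach [logn p t], hence the bound. *)
rewrite (@logn_bin _ _ _ (n + logn p t)) ?leq_addr //.
rewrite (@big_cat_nat _ _ _ (logn p t).+1) //= ?ltnS ?leq_addl //.
apply: leq_trans (leq_addr _ _).
rewrite -[leqLHS]muln1 -[X in (X * _)%N](subn1 (logn p t).+1) -sum_nat_const_nat.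
rewrite big_nat_cond [leqRHS]big_nat_cond; apply: leq_sum => k.
rewrite andbT ltnS => /andP[k0 kt]; rewrite H //.
- by rewrite -(exp1n k) ltn_exp2r // prime_gt1.
- exact: dvdn_trans (dvdn_exp2l _ kt) (pfactor_dvdnn _ _).
Qed.

Lemma oneBXn_neq0 (D : idomainType) i : (0 < i)%N -> 1 - 'X^i != 0 :> {poly D}.
Proof.
by move=> i0; rewrite -oppr_eq0 opprB -size_poly_gt0 -[1]/(1%:P) size_XnsubC.
Qed.

Lemma qpoch_neq0 n : qpoch n != 0.
Proof.
rewrite /qpoch prodf_seq_neq0; apply/allP => i.
by rewrite mem_index_iota => /andP[i0 _]; rewrite oneBXn_neq0.
Qed.

(** The roots of [1 - 'X^i] are simple because its derivative vanishes only at
    [0], characteristic zero being used for [i%:R != 0]. *)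
Lemma mup_oneBXn (F : numFieldType) d (z : F) i :
  d.-primitive_root z -> (0 < i)%N -> mup z (1 - 'X^i) = (d %| i)%N :> nat.
Proof.
move=> z_prim i0; have n0 := @oneBXn_neq0 F _ i0.
have rE : root (1 - 'X^i) z = (d %| i)%N.
  by rewrite rootE !hornerE subr_eq0 eq_sym (prim_order_dvd z_prim).
case: (d %| i)%N rE => rE; last by rewrite mupNroot ?rE.
apply/eqP; rewrite eqn_leq mup_geq // mup_leq // expr1 dvdp_XsubCl rE andbT.
(* A double root would be a root of the derivative. *)
apply/negP => /dvdpP[u /(congr1 (fun p => (p^`()).[z]))].
rewrite derivB -[1]/(1%:P) derivC derivXn derivM deriv_exp derivXsubC.
rewrite !hornerE hornerMn hornerXn.
rewrite /= subrr expr1 mulr0 !add0r subrr mulr0 => /eqP.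
rewrite oppr_eq0 mulrn_eq0 expf_eq0 (gtn_eqF i0) /= => /andP[_ /eqP z0].
have := prim_expr_order z_prim; rewrite z0 expr0n.
by rewrite gtn_eqF ?(prim_order_gt0 z_prim) // => /eqP; rewrite eq_sym oner_eq0.
Qed.

(** Clearing denominators returns to polynomials, where multiplicities of roots
    are available; ['X^1] keeps the factor [1 - q] an instance of [1 - 'X^i]. *)
Lemma qA_polynomial t N M : (0 < t)%N -> (M <= N)%N -> in_Zq (qA 1 t N M) ->
  exists p : {poly int},
    (1 - 'X^1) * qpoch N = p * ((1 - 'X^t) * (qpoch M * qpoch (N - M))).
Proof.
move=> t0 MN [p]; rewrite /qA /qbinom MN => hp; exists p.
apply/eqP; rewrite -tofrac_eq !(tofracM p, tofracM (1 - _)) -hp -tofracM mulf_div.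
by rewrite -!tofracM divfK // tofrac_eq0 !mulf_neq0 ?qpoch_neq0 ?oneBXn_neq0.
Qed.

Lemma map_poly_intr_neq0 (F : numFieldType) (q : {poly int}) :
  q != 0 -> map_poly intr q != 0 :> {poly F}.
Proof. by move=> q0; rewrite map_poly_eq0_id0 ?intr_eq0 ?lead_coef_eq0. Qed.

Lemma mup_qpoch (F : numFieldType) d (z : F) n : d.-primitive_root z ->
  mup z (map_poly intr (qpoch n)) = (n %/ d)%N.
Proof.
move=> z_prim; have d0 := prim_order_gt0 z_prim.
have E i : map_poly intr (1 - 'X^i : {poly int}) = 1 - 'X^i :> {poly F}.
  by rewrite rmorphB rmorph1 /= map_polyXn.
elim: n => [|n IHn].
  by rewrite /qpoch big_geq // rmorph1 div0n mupNroot // rootC oner_eq0.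
rewrite /qpoch big_nat_recr //= rmorphM /= E mupM ?oneBXn_neq0 //; last first.
  exact: map_poly_intr_neq0 (qpoch_neq0 _).
by rewrite [X in (X + _)%N]IHn (mup_oneBXn _ _ _ _ z_prim) // divnS // addnC.
Qed.

(** Equality of the multiplicities of a primitive [d]-th root of unity on both
    sides of [qA_polynomial]: the left side has [N %/ d], and the right side
    at least [1 + M %/ d + (N - M) %/ d]. *)
Lemma qA_in_Zq_carry (F : numFieldType) d (z : F) t N M :
  d.-primitive_root z -> (1 < d)%N -> (d %| t)%N -> (0 < t)%N -> (M <= N)%N ->
  in_Zq (qA 1 t N M) -> (N %% d < M %% d)%N.
Proof.
move=> z_prim d1 dt t0 MN /(qA_polynomial _ _ _ t0 MN)[p hp].
have p0 : p != 0.
  apply: contraTneq isT => p0; move/eqP: hp; rewrite p0 mul0r mulf_eq0.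
  by rewrite (negPf (qpoch_neq0 _)) orbF (negPf (oneBXn_neq0 _ _ _)).
have := congr1 (fun q => mup z (map_poly intr q)) hp.
rewrite !rmorphM /= !mupM ?mulf_neq0 ?map_poly_intr_neq0 ?qpoch_neq0
  ?oneBXn_neq0 //.
rewrite !(mup_qpoch _ _ _ _ z_prim) !rmorphB !rmorph1 /= !map_polyXn.
rewrite !(mup_oneBXn _ _ _ _ z_prim) // dt dvdn1 (gtn_eqF d1) /=.
rewrite (carry_divn d N M (ltnW d1) MN).
by case: (_ < _)%N; lia.
Qed.

(** The sum is geometric with ratio [x = z ^+ k / z ^+ M], an [n]-th root of
    unity: its value is [n] if [x = 1], and [x * (x ^+ n - 1) / (x - 1) = 0]
    otherwise. *)
Lemma sum_prim_root_expr (F : fieldType) n (z : F) k M : n.-primitive_root z ->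
  \sum_(1 <= j < n.+1) z ^- (j * M) * z ^+ (j * k) =
    (if (k == M %[mod n])%N then n else 0%N)%:R.
Proof.
move=> z_prim; have n0 := prim_order_gt0 z_prim.
have z0 : z != 0.
  apply/eqP => z0; have := prim_expr_order z_prim.
  by rewrite z0 expr0n gtn_eqF // => /eqP; rewrite eq_sym oner_eq0.
have E j : z ^- (j * M) * z ^+ (j * k) = (z ^+ k / z ^+ M) ^+ j.
  by rewrite expr_div_n -!exprM mulrC ![(_ * j)%N]mulnC.
under eq_bigr do rewrite E.
rewrite -(eq_prim_root_expr z_prim).
set x := z ^+ k / z ^+ M.
have x1 : (x == 1) = (z ^+ k == z ^+ M).
  by rewrite -(inj_eq (mulIf (expf_neq0 M z0))) divfK ?expf_neq0 // mul1r.
rewrite -x1; case: eqVneq => [->|xN1].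
  by under eq_bigr do rewrite expr1n; rewrite sumr_const_nat subn1.
have xn : x ^+ n = 1.
  rewrite expr_div_n -!exprM ![(_ * n)%N]mulnC !exprM.
  by rewrite (prim_expr_order z_prim) !expr1n divr1.
rewrite big_add1 /=.
under eq_bigr do rewrite exprS.
rewrite -mulr_sumr big_mkord; apply/eqP; rewrite mulf_eq0; apply/orP; right.
by have /eqP := subrX1 x n; rewrite xn subrr eq_sym mulf_eq0 subr_eq0 (negPf xN1).
Qed.

Lemma root_of_unity_filter (F : fieldType) n (z : F) N M : n.-primitive_root z ->
  \sum_(1 <= j < n.+1) z ^- (j * M) * (1 + z ^+ j) ^+ N =
    (n * \sum_(k < N.+1 | (k == M %[mod n])%N) 'C(N, k))%N%:R.
Proof.
move=> z_prim.
transitivity (\sum_(1 <= j < n.+1) \sum_(k < N.+1)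
    'C(N, k)%:R * (z ^- (j * M) * z ^+ (j * k))).
  apply: eq_bigr => j _; rewrite exprDn mulr_sumr; apply: eq_bigr => k _.
  by rewrite expr1n mul1r -mulr_natl mulrCA -!exprM.
rewrite exchange_big /= big_distrr /= natr_sum [RHS]big_mkcond /=.
apply: eq_bigr => k _; rewrite -mulr_sumr sum_prim_root_expr // -natrM mulnC.
by case: ifP; rewrite ?mul0n.
Qed.

Lemma expi_exp (R : realType) (t : R) j : expi t ^+ j = expi (t *+ j).
Proof.
have D (a b : R) : expi a * expi b = expi (a + b).
  rewrite /expi sinD cosD; apply/eqP.
  by rewrite eq_complex /= eqxx /= addrC eqxx.
elim: j => [|j IH].
  rewrite mulr0n expr0 /expi cos0 sin0.
  by apply/eqP; rewrite eq_complex /= !eqxx.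
by rewrite exprS IH D mulrS.
Qed.

(** For [0 < j < n] the half-angle [a = pi * j / n] lies strictly between [0]
    and [pi], so that [cos (2 * a) = 1 - 2 * sin a ^+ 2] is not [1]. *)
Lemma zeta_prim (R : realType) n : (0 < n)%N -> n.-primitive_root (zeta R n).
Proof.
move=> n0; apply/andP; split => //; apply/forallP => i.
have nR : (n%:R : R) != 0 by rewrite pnatr_eq0 -lt0n.
rewrite unity_rootE /zeta expi_exp; set a : R := pi / n%:R * i.+1%:R.
have -> : (2 * pi / n%:R : R) *+ i.+1 = a *+ 2.
  by rewrite /a -[LHS]mulr_natr -[RHS]mulr_natr; ring.
have [in_|in_] := eqVneq i.+1 n.
  have -> : a = pi by rewrite /a in_ divfK.
  by rewrite /expi cos2pi sin2pi eqxx.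
have lt : (i.+1 < n)%N by rewrite ltn_neqAle in_ ltn_ord.
have n0R : (0 : R) < n%:R by rewrite ltr0n.
have sa : 0 < sin a.
  apply: sin_gt0_pi; rewrite /a !mulr_gt0 ?invr_gt0 ?pi_gt0 ?ltr0n //=.
  by rewrite mulrAC ltr_pdivrMr // ltr_pM2l ?pi_gt0 // ltr_nat.
rewrite /expi eq_complex /= cos_mulr2n cos2sin2 eqbF_neg.
apply/negP => /andP[/eqP h _].
by have := exprn_gt0 2 sa; lra.
Qed.

Theorem theorem5 (R : realType) (n N M : nat) (hn : (0 < n)%N)
    (hMN : (M <= N)%N) (hA : in_Zq (qA 1 n N M)) (m : nat) :
  dvdC_int (n ^ 2)
    (\sum_(1 <= j < n.+1)
        zeta R n ^- (j * M) * (1 + zeta R n ^+ j) ^+ (N + m * n)).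
Proof.
rewrite root_of_unity_filter; last exact: zeta_prim.
set S := (\sum_(k < _ | _) _)%N; exists (n * S)%N%:Z; split=> //.
rewrite dvdzE /= -mulnn dvdn_pmul2l // /S; apply: dvdn_sum => k /eqP kM.
apply: dvdn_bin_carry => //; first by rewrite -ltnS ltn_ord.
move=> d d1 dn; rewrite -(modn_dvdm k dn) kM modn_dvdm //.
rewrite -modnDmr (eqP (dvdn_mull m dn)) addn0.
exact: (qA_in_Zq_carry _ _ _ _ _ _ (zeta_prim R d (ltnW d1)) d1 dn hn hMN hA).
Qed.
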